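(* Assume (A1), (A2) and that $\sigma$ is Lipschitz on $\mathbb R^n$. Let $u(t,x)=\max_{q\in\mathbb R^n}\{\langle x,q\rangle-\sigma^*(q)-\int_0^tH(\tau,q)\,d\tau\}$. If $u$ has a singular point $(t_0,x_0)\in\Omega$, then for any $\epsilon>0$ and any $t\in(t_0,T)$ there exists $x\in\mathbb R^n$ such that $(t,x)$ is another singular point of $u$ and $|x-x_0|\le m\epsilon$ for some $m\in\mathbb N$.
   Context: Let $T>0$ and $\Omega=(0,T)\times\mathbb R^n$. Let $H=H(t,p)$ be a real-valued function of class $C^1$ on $[0,T]\times\mathbb R^n$ and $\sigma:\mathbb R^n\to\mathbb R$ be convex and of class $C^1$. $\sigma^*:\mathbb R^n\to\mathbb R\cup\{+\infty\}$ is the Fenchel conjugate of $\sigma$. Condition (A1): for every $(t_0,x_0)\in[0,T)\times\mathbb R^n$ there exist positive constants $r$ and $N$ such that $$\langle x,p\rangle-\sigma^*(p)-\int_0^tH(\tau,p)\,d\tau<\max_{|q|\le N}\Big\{\langle x,q\rangle-\sigma^*(q)-\int_0^tH(\tau,q)\,d\tau\Big\}$$ whenever $(t,x)\in[0,T)\times\mathbb R^n$, $|t-t_0|+|x-x_0|<r$ and $|p|>N$. Condition (A2): $H$ has one of the two following forms: a) $H(t,\cdot)$ is convex for all $t\in(0,T)$, or $H(t,\cdot)$ is concave for all $t\in(0,T)$; b) $H(t,p)=g(t)h(p)+k(t)$ for some functions $g,h,k$, where $g(t)$ does not change its sign on $(0,T)$. A point $(t,x)\in\Omega$ is singular for $u$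 if $u$ is not differentiable (jointly in $(t,x)$) at this point. *)

(* Defs.v *)
From HB Require Import structures.
From mathcomp Require Import all_boot all_order all_algebra.
From mathcomp Require Import all_classical all_reals all_analysis.
Set Implicit Arguments.
Unset Strict Implicit.
Unset Printing Implicit Defensive.
Import Order.TTheory GRing.Theory Num.Theory.
Import numFieldNormedType.Exports.
Local Open Scope classical_set_scope.
Local Open Scope ring_scope.

(* The library norm on 'rV[R]_n is the sup norm, hence the explicit Euclidean
   inner product and norm. *)
Definition dot (R : realType) (n : nat) (x y : 'rV[R]_n) : R :=
  \sum_(i < n) x ord0 i * y ord0 i.

Definition enorm (R : realType) (n : nat) (x : 'rV[R]_n) : R :=
  Num.sqrt (dot x x).

(* Class C^1 relative to a possibly non-open set A: the Frechet derivative is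
   taken along A (so it is one-sided at boundary points of A) and is continuous
   on A. Pointwise continuity of df is continuity in operator norm when V has
   finite dimension. *)
Definition C1_on (R : realType) (V : normedModType R) (A : set V) (f : V -> R)
    : Prop :=
  exists df : V -> {linear V -> R^o},
    (forall v, {within A, continuous (fun x => df x v : R)}) /\
    (forall x, A x -> forall e : R, 0 < e ->
       \forall y \near within A (nbhs x),
         `|f y - f x - df x (y - x)| <= e * `|y - x|).

Definition fenchel (R : realType) (n : nat) (sigma : 'rV[R]_n -> R)
    (p : 'rV[R]_n) : \bar R :=
  ereal_sup (range (fun x => (dot p x - sigma x)%:E)).

(* The greatest element of A; the value is -oo by convention when A has none. *)
Definition emax (R : realType) (A : set (\bar R)) : \bar R :=
  xget -oo%E [set m | A m /\ ubound A m].

(* This is -oo exactly when sigma^*(q) = +oo. *)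
Definition phi (R : realType) (n : nat) (H : R -> 'rV[R]_n -> R)
    (sigma : 'rV[R]_n -> R) (t : R) (x q : 'rV[R]_n) : \bar R :=
  ((dot x q)%:E - fenchel sigma q
   - (\int[lebesgue_measure]_(tau in `[0%R, t]) H tau q)%R%:E)%E.

Definition hopf (R : realType) (n : nat) (H : R -> 'rV[R]_n -> R)
    (sigma : 'rV[R]_n -> R) (t : R) (x : 'rV[R]_n) : R :=
  fine (emax (range (phi H sigma t x))).

Definition condA1 (R : realType) (n : nat) (T : R) (H : R -> 'rV[R]_n -> R)
    (sigma : 'rV[R]_n -> R) : Prop :=
  forall (t0 : R) (x0 : 'rV[R]_n), 0 <= t0 < T ->
    exists r N : R, [/\ 0 < r, 0 < N &
      forall (t : R) (x p : 'rV[R]_n),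
        0 <= t < T -> `|t - t0| + enorm (x - x0) < r -> N < enorm p ->
        (phi H sigma t x p <
         emax (phi H sigma t x @` [set q | (enorm q <= N)%R]))%E].

Definition condA2 (R : realType) (n : nat) (T : R) (H : R -> 'rV[R]_n -> R)
    : Prop :=
  ((forall t, 0 < t < T -> convex_function setT (H t)) \/
   (forall t, 0 < t < T -> convex_function setT (fun p => - H t p))) \/
  (exists (g : R -> R) (h : 'rV[R]_n -> R) (k : R -> R),
     (forall t p, 0 <= t <= T -> H t p = g t * h p + k t) /\
     ((forall t, 0 < t < T -> 0 <= g t) \/ (forall t, 0 < t < T -> g t <= 0))).

Definition singular (R : realType) (n : nat) (T : R) (u : R -> 'rV[R]_n -> R)
    (t : R) (x : 'rV[R]_n) : Prop :=
  0 < t < T /\ ~ differentiable (fun z : R * 'rV[R]_n => u z.1 z.2) (t, x).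

(* Main.v *)
(* The maximand is <x, q> - f_t(q) with f_t = sigma^* + F_t and F_t = int_0^t H.
   At a fixed time, u is differentiable at (t, x) exactly when the maximizer is
   unique. Suppose that u has no singular point at a time t1 > t0. Then f_t1 is
   convex: its conjugate u(t1, .) is differentiable everywhere, and each q is a
   limit of maximizers q - eps x, x minimizing u(t1, x) - <x, q> + eps |x|^2 / 2,
   so lower semicontinuity gives the convexity inequality at q without any
   separation theorem. By (A2), f_t0 is either sigma^* + (convex), f_t1 + (convex)
   or a convex combination of sigma^* and f_t1 up to a constant. If q1 and q2
   maximize at (t0, x0), then the whole segment does, and sigma^* (or f_t1) is
   affine on it; the remaining term has a gradient at the midpoint, so q1 and q2
   are maximizers for a common slope of sigma^* (or f_t1), hence equal since sigma
   (or u(t1, .)) is differentiable. So u is differentiable at (t0, x0).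
   The Lipschitz bound makes the domain of sigma^* bounded, so that maximizers
   exist. *)

Require Import Defs.
From HB Require Import structures.
From mathcomp Require Import all_boot all_order all_algebra.
From mathcomp Require Import all_classical all_reals all_analysis.
From mathcomp Require Import ring lra.
Import Order.TTheory GRing.Theory Num.Theory.
Import numFieldNormedType.Exports.
Local Open Scope classical_set_scope.
Local Open Scope ring_scope.

(** * Maximizers of <x, q> - f q *)

Section dot_theory.
Context {R : realType} {n : nat}.
Implicit Types (x y z : 'rV[R]_n) (k : R).

Lemma dotC x y : dot x y = dot y x.
Proof. by apply: eq_bigr => i _; rewrite mulrC. Qed.

Lemma dotDl x y z : dot (x + y) z = dot x z + dot y z.
Proof. by rewrite -big_split; apply: eq_bigr => i _; rewrite mxE mulrDl. Qed.

Lemma dotZl k x y : dot (k *: x) y = k * dot x y.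
Proof. by rewrite /dot big_distrr; apply: eq_bigr => i _ /=; rewrite mxE mulrA. Qed.

Lemma dotDr x y z : dot x (y + z) = dot x y + dot x z.
Proof. by rewrite dotC dotDl !(dotC x). Qed.

Lemma dotZr k x y : dot x (k *: y) = k * dot x y.
Proof. by rewrite dotC dotZl dotC. Qed.

Lemma dotNl x y : dot (- x) y = - dot x y.
Proof. by rewrite -scaleN1r dotZl mulN1r. Qed.

Lemma dotNr x y : dot x (- y) = - dot x y.
Proof. by rewrite dotC dotNl dotC. Qed.

Definition dotE := (dotDl, dotDr, dotNl, dotNr, dotZl, dotZr).

Lemma dot_ge0 x : 0 <= dot x x.
Proof. by apply: sumr_ge0 => i _; rewrite -expr2 sqr_ge0. Qed.

Lemma dot_delta x i : dot x (delta_mx ord0 i) = x ord0 i.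
Proof.
rewrite /dot (bigD1 i)//= mxE !eqxx mulr1 big1 ?addr0// => j ji.
by rewrite mxE (negbTE ji) andbF mulr0.
Qed.

Lemma dot_inj x y : (forall v, dot x v = dot y v) -> x = y.
Proof. by move=> xy; apply/rowP => i; rewrite -!dot_delta xy. Qed.

Lemma norm_coord x i : `|x ord0 i| <= `|x|.
Proof.
rewrite [leRHS]/Num.norm /= mx_normrE.
by rewrite (le_bigmax _ (fun ij => `|x ij.1 ij.2|) (ord0, i)).
Qed.

(** Topology and boundedness are those of the sup norm, while the quadratic terms below are
    Euclidean; this inequality passes from one to the other. *)
Lemma sqr_norm_le_dot x : `|x| ^+ 2 <= dot x x.
Proof.
have [->|] := eqVneq `|x| 0; first by rewrite expr0n dot_ge0.
move=> /mx_norm_neq0[[k i]]/=; rewrite (ord1 k) => xE.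
rewrite [X in X ^+ 2]xE real_normK ?num_real// /dot (bigD1 i)//= expr2 lerDl.
by apply: sumr_ge0 => j _; rewrite -expr2 sqr_ge0.
Qed.

Lemma norm_dot_le x y : `|dot x y| <= n%:R * `|x| * `|y|.
Proof.
apply: (le_trans (ler_norm_sum _ _ _)).
rewrite -mulrA mulr_natl -[X in _ *+ X]card_ord -sumr_const ler_sum// => i _.
by rewrite normrM ler_pM// norm_coord.
Qed.

Lemma continuous_dot {T : topologicalType} (f g : T -> 'rV[R]_n) :
  continuous f -> continuous g -> continuous (fun t => dot (f t) (g t)).
Proof.
move=> cf cg; apply: continuous_big => [|i _]; first exact: add_continuous.
have cc h : continuous h -> continuous (fun t : T => (h t : 'rV[R]_n) ord0 i).
  move=> ch t; apply: (@continuous_comp _ _ _ h (fun y => y ord0 i)).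
    exact: ch.
  exact: coord_continuous.
by move=> t; apply: cvgM; exact: cc.
Qed.

Lemma dot_continuous x : continuous (dot x).
Proof. by apply: continuous_dot => y; [exact: cst_continuous|]. Qed.

Lemma dotxx_continuous : continuous (fun x : 'rV[R]_n => dot x x).
Proof. by apply: (@continuous_dot _ id id) => x; exact: cvg_id. Qed.

End dot_theory.

(** The nonempty sublevel sets generate a proper filter. It clusters at a point of one of them, and
    this point lies in all of them because compact sets are closed. Compactness of sublevel sets
    thus stands in for lower semicontinuity together with coercivity. *)
Lemma compact_sublevel_min {R : realType} {V : ptopologicalType} (D : set V)
    (f : V -> R) :
  D !=set0 -> (forall c, compact [set q | D q /\ f q <= c]) ->
  hausdorff_space V ->
  exists2 p, D p & forall q, D q -> f p <= f q.
Proof.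
move=> [d0 Dd0] Dc hV.
pose K c := [set q | D q /\ f q <= c].
pose F : set_system V := [set A | exists2 q, D q & K (f q) `<=` A].
have FF : ProperFilter F.
  split.
    by move=> [q Dq /(_ q)]; apply; split.
  split.
  - by exists d0.
  - move=> A B [a Da Ka] [b Db Kb].
    have [ab|ba] := leP (f a) (f b).
      exists a => // q [Dq qa]; split; [exact: Ka|apply: Kb].
      by split => //; exact: le_trans ab.
    exists b => // q [Dq qb]; split; [apply: Ka|exact: Kb].
    by split => //; apply: (le_trans qb); exact: ltW.
  - move=> A B AB [a Da Ka]; exists a => //.
    exact: subset_trans AB.
have [|p [[Dp _] clp]] := Dc (f d0) F FF.
  by exists d0.
exists p => // q Dq.
have /closure_id clK : closed (K (f q)) := compact_closed hV (Dc (f q)).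
suff : K (f q) p by case.
rewrite clK => B Bp.
by apply: clp => //; exists q.
Qed.

(** * Touching from below, proximal points and uniqueness of maximizers *)

Section convexity.
Context {R : realType} {n : nat}.
Local Notation V := 'rV[R]_n.
Implicit Types (D : set V) (f u : V -> R).

Definition is_max D f (x p : V) :=
  D p /\ forall q, D q -> dot x q - f q <= dot x p - f p.

(* For a supremum of affine functions this amounts to differentiability: a
   maximizer touches u from below, and so does q - eps x at a proximal point x. *)
Definition touch_unique u := forall (x a b : V) (C : R),
  (forall v, dot a v - C * dot v v <= u (x + v) - u x) ->
  (forall v, dot b v - C * dot v v <= u (x + v) - u x) -> a = b.

(** A maximizer at [x] is the slope of an affine minorant of [u] that is exact at [x], so it touches
    [u] with [C = 0]. *)
Lemma is_max_unique {D f u} : touch_unique u ->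
  (forall x, exists2 p, is_max D f x p & u x = dot x p - f p) ->
  forall x p q, is_max D f x p -> is_max D f x q -> p = q.
Proof.
move=> uU uE.
have le_u x p : D p -> dot x p - f p <= u x.
  by move=> Dp; have [q [_ qm] ->] := uE x; exact: qm.
have eq_u x p : is_max D f x p -> u x = dot x p - f p.
  move=> [Dp pm]; apply/eqP; rewrite eq_le le_u// andbT.
  by have [q [Dq _] ->] := uE x; exact: pm.
move=> x p q xp xq; apply: (uU x _ _ 0) => v; rewrite mul0r subr0.
  rewrite (eq_u _ _ xp); have := le_u (x + v) p xp.1.
  by rewrite dotDl (dotC v); lra.
rewrite (eq_u _ _ xq); have := le_u (x + v) q xq.1.
by rewrite dotDl (dotC v); lra.
Qed.

Lemma attained_max_ge {D f u} :
  (forall x, exists2 p, is_max D f x p & u x = dot x p - f p) ->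
  forall x p, D p -> dot x p - f p <= u x.
Proof. by move=> uE x p Dp; have [q [_ qm] ->] := uE x; exact: qm. Qed.

(** At a minimizer [x] of [u x - <x, q> + eps |x|^2 / 2], the slope [q - eps x] touches [u] from
    below up to a quadratic; so does any maximizer at [x], and [touch_unique] identifies the two. *)
Lemma prox_point {D f u} (q : V) (eps : R) : 0 < eps ->
  touch_unique u ->
  (forall x, exists2 p, is_max D f x p & u x = dot x p - f p) ->
  exists x, is_max D f x (q - eps *: x).
Proof.
move=> e0 uU uE; have le_u := attained_max_ge uE.
pose g x := u x - dot x q + eps / 2 * dot x x.
have [d0 Dd0] : D !=set0 by have [p [Dp _] _] := uE 0; exists p.
have [|c||x _ xmin] := @compact_sublevel_min R V setT g.
- by exists 0.
- apply: bounded_closed_compact; last first.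
    (* Since [u] is a supremum of affine functions, the sublevel set is an intersection of closed
       sets, one for each [p] in [D]. *)
    pose h p x := dot x p - f p - dot x q + eps / 2 * dot x x.
    rewrite (_ : mkset _ = \bigcap_(p in D) (h p @^-1` [set y | y <= c])).
      apply: closed_bigI => p Dp.
      apply: closed_comp; last exact: closed_le.
      have cd r : continuous (fun y : V => dot y r).
        by under eq_fun do rewrite dotC; exact: dot_continuous.
      move=> x _; apply: (cvgD (F := nbhs x)); last first.
        apply: (cvgMl_tmp (F := nbhs x)); exact: dotxx_continuous.
      apply: (cvgB (F := nbhs x)); last exact: cd.
      by apply: (cvgB (F := nbhs x)); [exact: cd|exact: cvg_cst].
    apply/seteqP; split => x /=.
      move=> [_ gx] p Dp; apply: le_trans gx.
      by rewrite /h /g lerD2r lerD2r le_u.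
    move=> hx; split=> //; rewrite /g.
    by have [p [Dp _] ->] := uE x; exact: hx.
  (* The affine minorant of [u] given by [d0] yields [eps |x|^2 / 2 <= A + B |x|] on the sublevel
     set; for [|x| > 1], dividing by [|x|] bounds [x]. *)
  pose A := `|c + f d0|; pose B := n%:R * `|d0 - q|.
  have A0 : 0 <= A by rewrite /A.
  have B0 : 0 <= B by rewrite /B mulr_ge0.
  exists (1 + (A + B) * 2 / eps); split; first exact: num_real.
  move=> M /ltW leM x [_ gx]; apply: le_trans leM.
  have dx : `|dot x (d0 - q)| <= B * `|x|.
    by rewrite (le_trans (norm_dot_le _ _))// /B mulrAC.
  have xx : eps / 2 * `|x| ^+ 2 <= A + B * `|x|.
    have : eps / 2 * `|x| ^+ 2 <= eps / 2 * dot x x.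
      by rewrite ler_pM2l ?divr_gt0// sqr_norm_le_dot.
    move: gx dx (le_u x d0 Dd0); rewrite /g !dotE ler_norml => + /andP[+ _].
    have := ler_norm (c + f d0); rewrite -/A.
    set Bx := B * `|x|; set ex := eps / 2 * dot x x; set ey := eps / 2 * _.
    lra.
  have [x1|x1] := leP `|x| 1.
    by rewrite (le_trans x1)// lerDl divr_ge0// ?(ltW e0)// mulr_ge0// addr_ge0.
  rewrite ler_wpDl// ler_pdivlMr// -(ler_pM2r (lt_trans ltr01 x1)).
  have : A <= A * `|x| by rewrite ler_peMr// ltW.
  move: xx; rewrite expr2; lra.
- exact: norm_hausdorff.
exists x; have [p xp ux] := uE x.
rewrite (_ : q - _ = p)//; apply: (uU x _ _ (eps / 2)) => v.
  move: (xmin (x + v) I); rewrite /g !dotE (dotC v x) (dotC q v).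
  lra.
rewrite ux; have := le_u (x + v) p xp.1; rewrite dotDl (dotC v).
have : 0 <= eps / 2 * dot v v by rewrite mulr_ge0 ?dot_ge0// divr_ge0// ltW.
lra.
Qed.

Lemma touch_unique_convex {D f u} :
  (forall c, compact [set q | D q /\ f q <= c]) ->
  touch_unique u ->
  (forall x, exists2 p, is_max D f x p & u x = dot x p - f p) ->
  forall (a b : V) (l : R), D a -> D b -> 0 <= l <= 1 ->
  D (l *: a + (1 - l) *: b) /\
  f (l *: a + (1 - l) *: b) <= l * f a + (1 - l) * f b.
Proof.
move=> Dc uU uE a b l Da Db /andP[l0 l1]; set q := _ + _; set c : R := _ + _.
have [|||m Dm mf] := @compact_sublevel_min R V D f.
- by exists a.
- exact: Dc.
- exact: norm_hausdorff.
suff : closure [set q | D q /\ f q <= c] q.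
  have /closure_id <- // : closed [set q | D q /\ f q <= c].
  by apply: compact_closed; [exact: norm_hausdorff|exact: Dc].
move=> B /nbhs_ballP[r /= r0 rB].
(* As [f m] is the minimum of [f], the bound on [f p] below gives [eps |x|^2 <= K]. Hence [|p - q|^2
   = eps^2 |x|^2 <= eps K = r^2 / 2], so [p] falls in the ball of radius [r] around [q]. *)
pose K := `|c - f m| + 1; have K0 : 0 < K by rewrite ltr_wpDl.
pose eps := r ^+ 2 / (2 * K).
have e0 : 0 < eps by rewrite divr_gt0 ?exprn_gt0 ?mulr_gt0.
have [x [Dp pm]] := prox_point q eps e0 uU uE.
set p := q - _ in Dp pm.
(* Average the maximality of [p] against [a] and [b] with weights [l] and [1 - l], and use
   [q - p = eps x]. *)
have fp : f p + eps * dot x x <= c.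
  have ha := pm a Da; have hb := pm b Db.
  have : l * (dot x a - f a) + (1 - l) * (dot x b - f b) <= dot x p - f p.
    have -> : dot x p - f p = l * (dot x p - f p) + (1 - l) * (dot x p - f p) by ring.
    by rewrite lerD// ler_wpM2l// subr_ge0.
  rewrite /c /p /q !dotE; lra.
have xx0 := dot_ge0 x.
exists p; split.
  by split=> //; apply: le_trans fp; rewrite lerDl mulr_ge0// ltW.
apply: rB; rewrite -ball_normE /ball_/= opprB addrC subrK.
rewrite -(ltr_pXn2r (n := 2)) ?nnegrE ?normr_ge0 ?(ltW r0)//.
apply: (le_lt_trans (sqr_norm_le_dot _)); rewrite !dotE mulrA.
have : eps * dot x x <= c - f m by have := mf p Dp; lra.
move=> h; have {h} : eps * dot x x <= K.
  by rewrite (le_trans h)// /K (le_trans (ler_norm _))// lerDl.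
move=> h; rewrite -mulrA (@le_lt_trans _ _ (eps * K))//.
  by rewrite ler_pM2l.
rewrite /eps invfM mulrA mulfVK ?gt_eqF// ltr_pdivrMr// ltr_pMr ?exprn_gt0//.
by rewrite ltr1n.
Qed.

(** The first-order condition at the midpoint [m] makes [m] a maximizer of [f] alone for the slope
    [x0 - g]. As [f] is affine between the endpoints at [m], both endpoints are maximizers for that
    slope too. [C] itself need not be convex, only differentiable at [m]. *)
Lemma segment_max_unique {D f} (C : V -> R) (x0 q1 q2 : V) (g : V) :
  (forall (a b : V) (l : R), D a -> D b -> 0 <= l <= 1 ->
    D (l *: a + (1 - l) *: b) /\
    f (l *: a + (1 - l) *: b) <= l * f a + (1 - l) * f b) ->
  (forall x p q, is_max D f x p -> is_max D f x q -> p = q) ->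
  let m := 2^-1 *: q1 + (1 - 2^-1) *: q2 in
  (forall v, h^-1 *: (C (m + h *: v) - C m : R^o) @[h --> 0^'] --> (dot g v : R^o)) ->
  D q1 -> D q2 ->
  is_max D (f \+ C) x0 m ->
  2^-1 * f q1 + (1 - 2^-1) * f q2 <= f m ->
  q1 = q2.
Proof.
move=> cf fU m Cm Dq1 Dq2 [Dm mm] fm.
(* Move from [m] towards [q] by a small [s]: convexity bounds the increment of [f], the gradient
   that of [C]; then divide by [s]. *)
have ym q : D q -> dot (x0 - g) q - f q <= dot (x0 - g) m - f m.
  move=> Dq; apply/ler_addgt0Pr => e e0.
  have /cvgrPdist_le /(_ e e0) := Cm (q - m).
  rewrite near_withinE => -[r /= r0 rC].
  pose s := Num.min (r / 2) 1.
  have s0 : 0 < s by rewrite lt_min divr_gt0//=.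
  have s1 : s <= 1 by rewrite ge_min lexx orbT.
  have sr : s < r by rewrite gt_min ltr_pdivrMr// ltr_pMr// ltr1n.
  have /= := rC s; rewrite sub0r normrN gtr0_norm// => /(_ sr (lt0r_neq0 s0)).
  rewrite ler_norml => /andP[+ _].
  set c := C _ - C m; rewrite [_ *: _]mulrC => cE.
  have {cE} : c <= s * (dot g (q - m) + e).
    by rewrite mulrC -ler_pdivrMr//; lra.
  have sE : m + s *: (q - m) = s *: q + (1 - s) *: m.
    by rewrite scalerBr scalerBl scale1r addrCA addrA.
  have [|Ds fs] := cf q m s Dq Dm; first by rewrite (ltW s0).
  have := mm _ Ds; rewrite /c sE /= => h1 h2.
  rewrite -(ler_pM2l s0); move: h1 h2 fs; rewrite !dotE.
  lra.
have y1 := ym q1 Dq1; have y2 := ym q2 Dq2.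
have mE y : dot y m = 2^-1 * dot y q1 + (1 - 2^-1) * dot y q2 by rewrite /m !dotE.
apply: (fU (x0 - g)); split=> // q /ym; move: y1 y2; rewrite !mE; lra.
Qed.

End convexity.

(** * The conjugate of sigma *)

Lemma convex_functionE {R : realType} {n : nat} (f : 'rV[R]_n -> R) :
  convex_function setT f -> forall a b (l : R), 0 <= l <= 1 ->
  f (l *: a + (1 - l) *: b) <= l * f a + (1 - l) * f b.
Proof.
move=> cf a b l /andP[l0 l1].
by apply: (cf (Itv01 l0 l1)); rewrite in_setE.
Qed.

(** Touching bounds the difference quotient below at step [h] and above at step [-h], up to an error
    of order [h]. Both quotients have the same limit, which therefore equals the slope in direction
    [v]. *)
Lemma derivable_touch_unique {R : realType} {n : nat} (u : 'rV[R]_n -> R) :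
  (forall x v, derivable (u : _ -> R^o) x v) -> touch_unique u.
Proof.
move=> du x a b C ha hb; apply: dot_inj => v.
have /cvg_ex[/= L /cvgrPdist_le uL] := du x v.
suff touchE c : (forall w, dot c w - C * dot w w <= u (x + w) - u x) ->
    dot c v = L by rewrite !touchE.
move=> {a b ha hb} hc; apply/eqP; rewrite -subr_eq0 -normr_le0.
apply/ler_addgt0Pr => e e0; rewrite add0r.
have := uL _ (divr_gt0 e0 (ltr0n _ 2)).
rewrite near_withinE => -[r /= r0 rL].
pose K := `|C * dot v v| + 1; have K0 : 0 < K by rewrite ltr_wpDl.
pose h := Num.min (r / 2) (e / 2 / K).
have h0 : 0 < h by rewrite lt_min !divr_gt0.
have hr : h < r by rewrite gt_min ltr_pdivrMr// ltr_pMr// ltr1n.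
have hK : `|C * dot v v| * h <= e / 2.
  have : h <= e / 2 / K by rewrite ge_min lexx orbT.
  rewrite ler_pdivlMr// => /(le_trans _); apply.
  by rewrite mulrC ler_wpM2l ?ltW// ltrDl.
have /= := rL h; rewrite sub0r normrN gtr0_norm// => /(_ hr (lt0r_neq0 h0)).
have /= := rL (- h); rewrite sub0r opprK gtr0_norm// oppr_eq0.
move=> /(_ hr (lt0r_neq0 h0)).
have := hc (h *: v); have := hc (- h *: v).
rewrite !dotE ![_ *: v + x]addrC invrN.
set up := u (x + h *: v); set um := u (x + - h *: v).
rewrite ![_ *: (_ - _)]mulrC mulrN -mulNr opprB.
move=> c1 c2; rewrite !ler_norml => /andP[_ +] /andP[+ _].
have {}c1 : (u x - um) / h <= dot c v + C * dot v v * h.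
  by rewrite ler_pdivrMr//; lra.
have {}c2 : dot c v - C * dot v v * h <= (up - u x) / h.
  by rewrite ler_pdivlMr//; lra.
have : `|C * dot v v * h| <= e / 2 by rewrite normrM (gtr0_norm h0).
by rewrite ler_norml => /andP[hl hu] d1 d2; apply/andP; split; lra.
Qed.

(** The whole line through [x] lies in [A], so the derivative along [A] gives a two-sided limit.
    This covers the space directions of [[0, T] x R^n], also at the end times. *)
Lemma C1_on_derivative {R : realType} {V : normedModType R} (A : set V)
    (f : V -> R) (df : {linear V -> R^o}) (x v : V) :
  (forall e : R, 0 < e -> \forall y \near within A (nbhs x),
     `|f y - f x - df (y - x)| <= e * `|y - x|) ->
  (forall h : R, A (x + h *: v)) ->
  h^-1 *: (f (x + h *: v) - f x : R^o) @[h --> 0^'] --> df v.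
Proof.
move=> xdf Av; apply/cvgrPdist_le => e e0.
have e'0 : 0 < e / (`|v| + 1) by rewrite divr_gt0// ltr_wpDl.
have := xdf _ e'0; rewrite near_withinE => xe.
have cx : x + h *: v @[h --> 0] --> x.
  rewrite -[X in _ --> X]addr0 -[X in _ + X](scale0r v).
  by apply: cvgD; [exact: cvg_cst|apply: cvgZr_tmp; exact: cvg_id].
have {}xe : \forall h \near 0^',
    `|f (x + h *: v) - f x - df (h *: v)| <= e / (`|v| + 1) * `|h *: v|.
  apply: nbhs_dnbhs; move: (cx _ xe); apply: (filterS (F := nbhs (0 : R))).
  by move=> h /= /(_ (Av h)); rewrite (_ : x + h *: v - x = h *: v) // addrC addKr.
have h0 : \forall h \near (0 : R)^', h != 0 by exact: nbhs_dnbhs_neq.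
near=> h.
have hn0 : h != 0 by near: h.
have xeh : `|f (x + h *: v) - f x - df (h *: v)| <= e / (`|v| + 1) * `|h *: v|.
  by near: h.
have nh0 : 0 < `|h| by rewrite normr_gt0.
rewrite -(ler_pM2l nh0) -normrM mulrBr [_ *: _]mulrC mulrCA divff// mulr1.
rewrite distrC; move: xeh; rewrite linearZ/= => /le_trans; apply.
rewrite normrZ mulrCA ler_pM2l// mulrAC ler_pdivrMr ?ltr_wpDl//.
by rewrite ler_pM2l// lerDl.
Unshelve. all: by end_near. Qed.

Section conjugate.
Context {R : realType} {n : nat}.
Local Notation V := 'rV[R]_n.
Variable sigma : V -> R.

(** The effective domain of the conjugate; [rconj] is meaningful only on it, since [fine] sends
    [+oo] to a default value. *)
Definition conj_dom : set V :=
  [set q | exists M, forall x, dot q x - sigma x <= M].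

Definition rconj (q : V) : R := fine (fenchel sigma q).

Lemma fenchel_dom q : conj_dom q -> fenchel sigma q = (rconj q)%:E.
Proof.
move=> [M qM]; rewrite /rconj fineK// fin_numE; apply/andP; split.
  rewrite gt_eqF// (@lt_le_trans _ _ (dot q 0 - sigma 0)%:E)// ?ltNyr//.
  by apply: ereal_sup_ubound; exists 0.
rewrite lt_eqF// (@le_lt_trans _ _ M%:E)// ?ltry//.
by apply: ge_ereal_sup => _ [x _ <-]; rewrite lee_fin.
Qed.

Lemma fenchel_ndom q : ~ conj_dom q -> fenchel sigma q = +oo%E.
Proof.
move=> nq; apply/eqP; rewrite -[_ == _]negbK -ltey; apply/negP => qy.
apply: nq; exists (rconj q) => x; rewrite -lee_fin /rconj fineK.
  by apply: ereal_sup_ubound; exists x.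
rewrite fin_numE (lt_eqF qy) andbT.
rewrite gt_eqF// (@lt_le_trans _ _ (dot q 0 - sigma 0)%:E)// ?ltNyr//.
by apply: ereal_sup_ubound; exists 0.
Qed.

(** Sublevel sets of the conjugate are intersections of closed half-spaces; its convexity and the
    closedness of perturbed sublevel sets come from this. *)
Lemma conj_leP q c :
  (conj_dom q /\ rconj q <= c) <-> forall x, dot q x - sigma x <= c.
Proof.
split=> [[/fenchel_dom qE qc] x|qc].
  apply: le_trans qc; rewrite -lee_fin -qE.
  by apply: ereal_sup_ubound; exists x.
have Dq : conj_dom q by exists c.
split=> //; rewrite -lee_fin -fenchel_dom//.
by apply: ge_ereal_sup => _ [x _ <-]; rewrite lee_fin.
Qed.

Lemma fenchel_young q x : conj_dom q -> dot q x - sigma x <= rconj q.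
Proof. by move=> Dq; exact: ((conj_leP q _).1 (conj Dq (lexx _))). Qed.

Lemma conj_convex a b l : conj_dom a -> conj_dom b -> 0 <= l <= 1 ->
  conj_dom (l *: a + (1 - l) *: b) /\
  rconj (l *: a + (1 - l) *: b) <= l * rconj a + (1 - l) * rconj b.
Proof.
move=> Da Db /andP[l0 l1]; apply/conj_leP => x.
have : l * (dot a x - sigma x) <= l * rconj a by rewrite ler_wpM2l// fenchel_young.
have : (1 - l) * (dot b x - sigma x) <= (1 - l) * rconj b.
  by rewrite ler_wpM2l ?subr_ge0// fenchel_young.
rewrite !dotE; lra.
Qed.

(** If [|q| > k], then [<q, x> - sigma x] grows at least like [s |q| (|q| - k)] along the ray
    [x = s q], so it is unbounded. *)
Lemma conj_dom_bounded : lipschitz sigma -> exists k, forall q, conj_dom q -> `|q| <= k.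
Proof.
move=> [k0 [_ sk]].
(* [lipschitz] gives the bound only for constants strictly above [k0]; the maximum with 1 makes [k]
   positive. *)
pose k := Num.max 1 (k0 + 1).
have k1 : 1 <= k by rewrite le_max lexx.
have kP x y : `|sigma x - sigma y| <= k * `|x - y|.
  have k0k : k0 < k by rewrite lt_max ltrDl ltr01 orbT.
  exact: (sk _ k0k (x, y)).
exists k => q [M qM]; rewrite leNgt; apply/negP => kq.
have q0 : 0 < `|q| by apply: lt_trans kq; apply: lt_le_trans k1.
have d0 : 0 < `|q| * (`|q| - k) by rewrite mulr_gt0// subr_gt0.
pose s := (`|M + sigma 0| + 1) / (`|q| * (`|q| - k)).
have s0 : 0 < s by rewrite divr_gt0// ltr_wpDl.
have := qM (s *: q); rewrite dotE.
have := kP (s *: q) 0; rewrite subr0 normrZ (gtr0_norm s0) ler_norml => /andP[_ +].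
have : s * `|q| ^+ 2 <= s * dot q q by rewrite ler_pM2l// sqr_norm_le_dot.
have : s * (`|q| * (`|q| - k)) = `|M + sigma 0| + 1 by rewrite mulfVK// gt_eqF.
have := ler_norm (M + sigma 0); rewrite expr2.
set N := `|q|; set A := `|M + _|; set dq := dot q q.
lra.
Qed.

Lemma conj_sublevel_compact (F : V -> R) (c : R) :
  lipschitz sigma -> continuous F ->
  compact [set q | conj_dom q /\ rconj q + F q <= c].
Proof.
move=> lip cF; apply: bounded_closed_compact.
  have [k kD] := conj_dom_bounded lip.
  exists k; split; first exact: num_real.
  by move=> M /ltW kM q [/kD qk _]; exact: le_trans kM.
pose h x q := dot x q - sigma x + F q.
rewrite (_ : mkset _ = \bigcap_(x in setT) (h x @^-1` [set y | y <= c])).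
  apply: closed_bigI => x _; apply: closed_comp; last exact: closed_le.
  move=> q _; apply: (cvgD (F := nbhs q)); last exact: cF.
  by apply: (cvgB (F := nbhs q)); [exact: dot_continuous|exact: cvg_cst].
apply/seteqP; split => q /=.
  move=> [Dq qc] x _ /=; rewrite /h dotC.
  by have := fenchel_young _ x Dq; lra.
move=> qh; have [|Dq qc] := (conj_leP q (c - F q)).2.
  by move=> x; have := qh x I; rewrite /= /h dotC; lra.
by split=> //; lra.
Qed.

(** A subgradient gives equality in the Fenchel-Young inequality, so [sigma] is the attained
    conjugate of its conjugate. *)
Lemma conj_max (G : V -> V) :
  (forall y x, sigma y + dot (G y) (x - y) <= sigma x) ->
  forall y, is_max conj_dom rconj y (G y) /\ sigma y = dot y (G y) - rconj (G y).
Proof.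
move=> gradG y.
have [DG GE] : conj_dom (G y) /\ rconj (G y) <= dot (G y) y - sigma y.
  by apply/conj_leP => x; have := gradG y x; rewrite !dotE; lra.
have GE' := fenchel_young _ y DG.
have yE : sigma y = dot y (G y) - rconj (G y) by rewrite dotC; lra.
split=> //; split=> // q /(fenchel_young _ y); rewrite -yE dotC; lra.
Qed.

End conjugate.

(** By convexity the difference quotient from [y] towards [x] is at most [sigma x - sigma y]; the
    limit is the gradient inequality. *)
Lemma convex_C1_gradient {R : realType} {n : nat} (sigma : 'rV[R]_n -> R) :
  convex_function setT sigma -> C1_on setT sigma ->
  (forall x v, derivable (sigma : _ -> R^o) x v) /\
  exists G : 'rV[R]_n -> 'rV[R]_n,
    forall y x, sigma y + dot (G y) (x - y) <= sigma x.
Proof.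
move=> /convex_functionE cs [ds [_ dsP]].
have dsE x v : h^-1 *: (sigma (x + h *: v) - sigma x : R^o) @[h --> 0^'] --> ds x v.
  by apply: (@C1_on_derivative _ _ setT) => //; exact: dsP.
split.
  move=> x v; apply/cvg_ex; exists (ds x v) => /=.
  by under eq_fun do rewrite /= [_ + x]addrC; exact: dsE.
exists (fun y => \row_i ds y (delta_mx ord0 i)) => y x.
have -> : dot (\row_i ds y (delta_mx ord0 i)) (x - y) = ds y (x - y).
  rewrite [in RHS](row_sum_delta (x - y)) linear_sum; apply: eq_bigr => i _.
  by rewrite mxE linearZ/= mulrC.
rewrite -lerBrDl; apply/ler_addgt0Pr => e e0.
have /cvgrPdist_le /(_ e e0) := dsE y (x - y).
rewrite near_withinE => -[r /= r0 rC].
pose s := Num.min (r / 2) 1.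
have s0 : 0 < s by rewrite lt_min divr_gt0//=.
have s1 : s <= 1 by rewrite ge_min lexx orbT.
have sr : s < r by rewrite gt_min ltr_pdivrMr// ltr_pMr// ltr1n.
have /= := rC s; rewrite sub0r normrN gtr0_norm// => /(_ sr (lt0r_neq0 s0)).
rewrite ler_norml => /andP[_ +].
have sE : y + s *: (x - y) = s *: x + (1 - s) *: y.
  by rewrite scalerBr scalerBl scale1r addrCA addrA.
rewrite sE [_ *: _]mulrC.
have := cs x y s; rewrite (ltW s0) => /(_ s1) h.
have : (sigma (s *: x + (1 - s) *: y) - sigma y) / s <= sigma x - sigma y.
  by rewrite ler_pdivrMr//; lra.
lra.
Qed.

(** * The time integral of H *)

(** [C1_on] provides merely linear derivatives; their boundedness, needed for the continuity of [H],
    comes from finite dimension. *)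
Lemma linear_prod_bounded {R : realType} {n : nat}
    (L : {linear (R * 'rV[R]_n)%type -> R^o}) :
  exists2 C : R, 0 < C & forall w, `|L w : R| <= C * `|w|.
Proof.
pose C := `|L (1, 0) : R| + \sum_(i < n) `|L (0, delta_mx ord0 i) : R|.
have C0 : 0 <= C by rewrite addr_ge0// sumr_ge0.
exists (C + 1) => [|[s v]]; first by rewrite ltr_wpDl.
have [sv vv] : `|s| <= `|(s, v)| /\ `|v| <= `|(s, v)|.
  by rewrite prod_normE/= !le_max !lexx orbT.
have svE : (s, v) = s *: (1 : R^o, 0 : 'rV[R]_n) + (0, v).
  by congr pair; rewrite /= ?scaler0 ?add0r// addr0 [_ *: _]mulr1.
have L0D (a b : 'rV[R]_n) : L (0, a + b) = L (0, a) + L (0, b).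
  by rewrite -linearD; congr (L (_, _)); rewrite addr0.
have L0Z k (a : 'rV[R]_n) : L (0, k *: a) = k * L (0, a).
  have <- : L (k *: (0, a)) = k * L (0, a) by exact: linearZ.
  by congr (L (_, _)); rewrite scaler0.
have L00 : L (0, 0) = 0 by exact: (linear0 L).
rewrite [X in L X]svE linearD linearZ/=.
rewrite [X in L (0, X)](row_sum_delta v) (big_morph _ L0D L00).
apply: (@le_trans _ _ (C * `|(s, v)|)); last by rewrite ler_wpM2r// lerDl.
rewrite (le_trans (ler_normD _ _))// mulrDl lerD//.
  by rewrite normrM mulrC ler_wpM2l.
rewrite (le_trans (ler_norm_sum _ _ _))// mulr_suml ler_sum// => i _.
rewrite L0Z normrM mulrC ler_wpM2l// (le_trans _ vv)//.
exact: norm_coord.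
Qed.

(** Half-open intervals appear because increments in [t] of the integral over [[0, t]] are integrals
    over []s, t]]. *)
Lemma Rintegral_oc_dist {R : realType} (f : R -> R) (s t c e : R) : s <= t ->
  (@lebesgue_measure R).-integrable `]s, t] (EFin \o f) ->
  (forall tau, s < tau <= t -> `|f tau - c| <= e) ->
  `|\int[@lebesgue_measure R]_(tau in `]s, t]) f tau - c * (t - s)| <= e * (t - s).
Proof.
move=> st intf fc.
have cstE k : (\int[@lebesgue_measure R]_(tau in `]s, t]) k = k * (t - s))%R.
  rewrite Rintegral_cst//= lebesgue_measure_itv/= lte_fin.
  have [|ts] := ltP s t; first by [].
  by rewrite (_ : t = s) ?subrr//; apply/eqP; rewrite eq_le st ts.
have intc k : (@lebesgue_measure R).-integrable `]s, t] (EFin \o (fun=> k)).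
  have : (@lebesgue_measure R).-integrable `[s, t] (EFin \o (cst k : R -> R)).
    apply: continuous_compact_integrable; first exact: segment_compact.
    by apply: continuous_subspaceT => x; exact: cvg_cst.
  by apply: integrableS => //; exact: subset_itv_oc_cc.
rewrite ler_distl -mulrBl -mulrDl -!cstE.
apply/andP; split.
  apply: le_Rintegral => // x; rewrite /= in_itv/= => /fc.
  by rewrite ler_distl => /andP[].
apply: le_Rintegral => // x; rewrite /= in_itv/= => /fc.
by rewrite ler_distl => /andP[].
Qed.

Section time_integral.
Context {R : realType} {n : nat} (T : R) (H : R -> 'rV[R]_n -> R).
Local Notation V := 'rV[R]_n.
Local Notation A := [set z : R * V | 0 <= z.1 <= T].
Local Notation mu := (@lebesgue_measure R).
Context (H_C1 : C1_on A (fun z : R * V => H z.1 z.2)).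

Let F (t : R) (q : V) : R := (\int[mu]_(tau in `[0%R, t]) H tau q)%R.

Lemma C1_within_continuous : {within A, continuous (fun z : R * V => H z.1 z.2)}.
Proof.
have [dH [_ dHP]] := H_C1.
apply/subspace_continuousP => x Ax.
have [C C0 CP] := linear_prod_bounded (dH x).
apply/cvgrPdist_le => e e0.
have := dHP x Ax 1 ltr01; rewrite !near_withinE => h.
have h2 : \forall z \near x, `|x - z| <= e / (1 + C).
  apply: (cvgr_dist_le (F := nbhs x)); first exact: cvg_id.
  by rewrite divr_gt0// addr_gt0.
move: h2; apply: (filterS2 (F := nbhs x)); last exact: h.
move=> z hz xz /[dup] Az /hz; rewrite mul1r => {}hz.
rewrite distrC -[_ - _](subrK (dH x (z - x))) (le_trans (ler_normD _ _))//.
rewrite (@le_trans _ _ ((1 + C) * `|x - z|))//.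
  rewrite mulrDl mul1r lerD ?(distrC x) ?CP// hz//.
by rewrite mulrC -ler_pdivlMr ?addr_gt0.
Qed.

Lemma slice_continuous q : {within `[0, T], continuous (H^~ q)}.
Proof.
apply/subspace_continuousP => t /=; rewrite in_itv/= => tT.
have /subspace_continuousP /(_ (t, q) tT) := C1_within_continuous.
move=> /cvgrPdist_le tq; apply/cvgrPdist_le => e /tq; rewrite !near_withinE.
have pc : (tau, q) @[tau --> t] --> (t, q).
  have h1 : (tau : R) @[tau --> t] --> t by exact: cvg_id.
  have h2 : q @[tau --> t] --> q by exact: cvg_cst.
  exact: (cvg_pair h1 h2).
move=> /pc; apply: (filterS (F := nbhs t)) => tau /= h.
by rewrite in_itv/= => /h.
Qed.

Lemma slice_integrable q s t : 0 <= s -> t <= T ->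
  mu.-integrable `[s, t] (EFin \o H^~ q).
Proof.
move=> s0 tT; apply: continuous_compact_integrable; first exact: segment_compact.
apply: continuous_subspaceW (slice_continuous q).
by apply: subset_itvScc; rewrite bnd_simp.
Qed.

Lemma slice_integrable_oc q s t : 0 <= s -> t <= T ->
  mu.-integrable `]s, t] (EFin \o H^~ q).
Proof.
move=> s0 tT; apply: integrableS (slice_integrable q s t s0 tT) => //.
exact: subset_itv_oc_cc.
Qed.

Lemma time_integralB q s t : 0 <= s <= t -> t <= T ->
  F t q - F s q = (\int[mu]_(tau in `]s, t]) H tau q)%R.
Proof.
move=> /andP[s0 st] tT; apply: Rintegral_itvB; rewrite ?bnd_simp//.
exact: slice_integrable.
Qed.

Lemma time_integral0 q : F 0 q = 0.
Proof. by rewrite /F set_itv1 Rintegral_set1. Qed.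

Lemma time_integralE q t : 0 <= t <= T ->
  F t q = (\int[mu]_(tau in `]0, t]) H tau q)%R.
Proof.
move=> /andP[t0 tT]; rewrite -time_integralB ?lexx//.
by rewrite time_integral0 subr0.
Qed.

Lemma slice_bounded (rho : R) : exists M : R, forall tau q,
  0 <= tau <= T -> `|q| <= rho -> `|H tau q| <= M.
Proof.
pose B := [set q : V | `|q| <= rho].
have cB : compact B.
  apply: bounded_closed_compact.
    by exists rho; split=> [|M /ltW rM q /le_trans]; [exact: num_real|exact].
  apply: (@closed_comp _ _ (fun q : V => `|q|) [set y | y <= rho]) => [q _|].
    exact: norm_continuous.
  exact: closed_le.
have cK : compact (`[0, T]%classic `*` B).
  by apply: compact_setX => //; exact: segment_compact.
have cH : {within `[0, T]%classic `*` B, continuous (fun z : R * V => H z.1 z.2)}.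
  apply: continuous_subspaceW C1_within_continuous => -[tau q] [/=].
  by rewrite in_itv.
have /compact_bounded[M [_ HM]] := continuous_compact cH cK.
exists (M + 1) => tau q tauT qr; apply: HM; first by rewrite ltrDl.
by exists (tau, q) => //; split => //=; rewrite in_itv.
Qed.

(** Compactness of [[0, T]] makes the continuity of [H] in [q] uniform in time. *)
Lemma slice_near (q0 : V) (e : R) : 0 < e ->
  \forall q \near q0, forall tau, 0 <= tau <= T -> `|H tau q - H tau q0| <= e.
Proof.
move=> e0.
pose P (q : V) tau := 0 <= tau <= T -> `|H tau q - H tau q0| <= e.
suff : \forall q \near q0, `[0, T]%classic `<=` P q.
  apply: (filterS (F := nbhs q0)) => q h tau tauT.
  by apply: (h tau _ tauT); rewrite /= in_itv.
have /compact_near_coveringP cov := @segment_compact R 0 T.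
apply: (cov V (nbhs q0) P (nbhs_filter q0)).
move=> t /=; rewrite in_itv/= => tT.
have /subspace_continuousP /(_ (t, q0) tT) := C1_within_continuous.
move=> /cvgrPdist_le /(_ (e / 2)) => /(_ (divr_gt0 e0 (ltr0n _ 2))).
rewrite near_withinE => -[[B1 B2] /= [tB1 qB2] h].
exists (B1, B2) => //= -[tau q] [/= tB qB] tauT.
have h1 : `|H t q0 - H tau q| <= e / 2 := h (tau, q) (conj tB qB) tauT.
have h2 : `|H t q0 - H tau q0| <= e / 2 :=
  h (tau, q0) (conj tB (nbhs_singleton qB2)) tauT.
move: h1 h2; rewrite /= !ler_distl => /andP[a1 a2] /andP[b1 b2].
apply/andP; split; lra.
Qed.

Lemma time_integral_continuous t : 0 <= t <= T -> continuous (F t).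
Proof.
move=> /andP[t0 tT] q0.
apply: (cvgrPdist_le (F := nbhs q0) (F t) (F t q0)).2 => e e0.
have e'0 : 0 < e / (t + 1) by rewrite divr_gt0// ltr_wpDl.
have := slice_near q0 _ e'0; apply: (filterS (F := nbhs q0)) => q qe.
rewrite !time_integralE ?t0// -RintegralB//; last 2 first.
- exact: slice_integrable_oc.
- exact: slice_integrable_oc.
rewrite -[X in `|X|]subr0 -[X in _ - X](mul0r (t - 0)).
apply: le_trans (Rintegral_oc_dist _ _ _ _ (e / (t + 1)) t0 _ _) _.
- rewrite (_ : EFin \o _ = (fun x => ((EFin \o H^~ q0) x - (EFin \o H^~ q) x)%E))//.
  by apply: integrableB => //; exact: slice_integrable_oc.
- move=> tau /andP[tau0 taut]; rewrite subr0 distrC qe//.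
  by rewrite (ltW tau0) (le_trans taut).
by rewrite subr0 mulrAC ler_pdivrMr ?ltr_wpDl// ler_pM2l// lerDl.
Qed.

Lemma time_integral_lipschitz (rho : R) : exists2 M : R, 0 <= M & forall s t q,
  0 <= s <= T -> 0 <= t <= T -> `|q| <= rho -> `|F t q - F s q| <= M * `|t - s|.
Proof.
have [M HM] := slice_bounded rho.
have [r0|r0] := ltP rho 0.
  exists 0 => // s t q _ _ qr; have := le_lt_trans qr r0.
  by rewrite normr_lt0.
exists `|M| => // s t q.
wlog st : s t / s <= t => [ih sT tT qr|].
  have [st|/ltW ts] := leP s t; first exact: ih.
  by rewrite distrC (distrC t); exact: ih.
move=> /andP[s0 sT] /andP[t0 tT] qr.
rewrite time_integralB ?s0// [`|t - s|]ger0_norm ?subr_ge0//.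
rewrite -[X in `|X|]subr0 -[X in _ - X](mul0r (t - s)).
apply: Rintegral_oc_dist => //; first exact: slice_integrable_oc.
move=> tau /andP[stau taut]; rewrite subr0 (le_trans _ (ler_norm _))// HM//.
by rewrite (le_trans taut)// (le_trans s0)// ltW.
Qed.

(** The time expansion is uniform in the second variable near [q0], by joint continuity of [H]; this
    allows the maximizer to move with the point. *)
Lemma time_integral_expansion (t0 : R) (q0 : V) (e : R) : 0 <= t0 <= T -> 0 < e ->
  \forall z \near (t0, q0), 0 <= z.1 <= T ->
    `|F z.1 z.2 - F t0 z.2 - H t0 q0 * (z.1 - t0)| <= e * `|z.1 - t0|.
Proof.
move=> t0T e0.
have /subspace_continuousP /(_ (t0, q0) t0T) := C1_within_continuous.
move=> /cvgrPdist_le /(_ e e0); rewrite near_withinE.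
move=> /nbhs_ballP[r /= r0 rH]; apply/nbhs_ballP; exists r => //.
move=> [t q] [/= tr qr] tT.
have Hc tau : 0 <= tau <= T -> `|t0 - tau| < r -> `|H tau q - H t0 q0| <= e.
  by move=> tauT t0tau; rewrite distrC; apply: (rH (tau, q)) => //; split.
have [t0t|/ltW tt0] := leP t0 t.
  have ge0 : 0 <= t - t0 by rewrite subr_ge0.
  have [t00 _] := andP t0T; have [_ tT'] := andP tT.
  rewrite time_integralB ?t00// (ger0_norm ge0).
  apply: Rintegral_oc_dist => //; first exact: slice_integrable_oc.
  move=> tau /andP[t0tau taut]; apply: Hc.
    by rewrite (le_trans taut)// (le_trans t00)// ltW.
  move: tr; rewrite -ball_normE /ball_/= distrC (ger0_norm ge0).
  rewrite distrC gtr0_norm ?subr_gt0//; apply: le_lt_trans.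
  by rewrite lerD2r.
have ge0 : 0 <= t0 - t by rewrite subr_ge0.
have [_ t0T'] := andP t0T; have [t0' _] := andP tT.
have -> : F t q - F t0 q - H t0 q0 * (t - t0) =
    - (F t0 q - F t q - H t0 q0 * (t0 - t)) by ring.
rewrite normrN (distrC t).
rewrite time_integralB ?t0'// (ger0_norm ge0).
apply: Rintegral_oc_dist => //; first exact: slice_integrable_oc.
move=> tau /andP[ttau taut]; apply: Hc.
  by rewrite (le_trans taut)// (le_trans t0')// ltW.
move: tr; rewrite -ball_normE /ball_/= (ger0_norm ge0).
by rewrite ger0_norm ?subr_ge0//; apply: le_lt_trans; rewrite lerD2l lerN2 ltW.
Qed.

End time_integral.

(** * Consequences of (A2) for the time integral *)

Section time_integral_structure.
Context {R : realType} {n : nat} (T : R) (H : R -> 'rV[R]_n -> R).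
Local Notation V := 'rV[R]_n.
Local Notation A := [set z : R * V | 0 <= z.1 <= T].
Local Notation mu := (@lebesgue_measure R).
Context (H_C1 : C1_on A (fun z : R * V => H z.1 z.2)).

Let F (t : R) (q : V) : R := (\int[mu]_(tau in `[0%R, t]) H tau q)%R.

(** Three terms suffice for the convexity inequality and for the proportionality relations of the
    separable case. *)
Lemma time_integral_comb k1 k2 k3 a b c s t : 0 <= s <= t -> t <= T ->
  (\int[mu]_(tau in `]s, t]) (k1 * H tau a + k2 * H tau b + k3 * H tau c))%R =
  k1 * (F t a - F s a) + k2 * (F t b - F s b) + k3 * (F t c - F s c).
Proof.
move=> st tT; rewrite !(time_integralB T H H_C1)//.
have [s0 _] := andP st.
have iH q : mu.-integrable `]s, t] (EFin \o H^~ q).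
  exact: (slice_integrable_oc T H H_C1).
have mD : measurable (`]s, t]%classic : set (measurableTypeR R)).
  exact: measurable_itv.
have iZ k q : mu.-integrable `]s, t] (EFin \o (fun tau => k * H tau q)).
  exact: (integrableZl mD k (iH q)).
have iD : mu.-integrable `]s, t] (EFin \o (fun tau => k1 * H tau a + k2 * H tau b)).
  exact: (integrableD mD (iZ k1 a) (iZ k2 b)).
rewrite (RintegralD mD iD (iZ k3 c)) (RintegralD mD (iZ k1 a) (iZ k2 b)).
by rewrite !RintegralZl.
Qed.

(** With [t < T], the interval []s, t]] lies inside [(0, T)], where (A2) gives information. *)
Lemma time_integral_comb_ge0 k1 k2 k3 a b c s t : 0 <= s <= t -> t < T ->
  (forall tau, 0 < tau < T -> 0 <= k1 * H tau a + k2 * H tau b + k3 * H tau c) ->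
  0 <= k1 * (F t a - F s a) + k2 * (F t b - F s b) + k3 * (F t c - F s c).
Proof.
move=> st tT k0; rewrite -time_integral_comb ?(ltW tT)//.
apply: Rintegral_ge0 => tau; rewrite /= in_itv/= => /andP[stau taut].
have [s0 _] := andP st.
by apply: k0; rewrite (le_lt_trans s0)// (le_lt_trans taut).
Qed.

Lemma time_integral_comb_eq0 k1 k2 k3 a b c t : 0 <= t < T ->
  (forall tau, 0 < tau < T -> k1 * H tau a + k2 * H tau b + k3 * H tau c = 0) ->
  k1 * F t a + k2 * F t b + k3 * F t c = 0.
Proof.
move=> /andP[t0 tT] k0.
have F0 q : F 0 q = 0 by exact: time_integral0.
have st : 0 <= (0 : R) <= t by rewrite lexx.
have h1 : 0 <= k1 * (F t a - F 0 a) + k2 * (F t b - F 0 b) + k3 * (F t c - F 0 c).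
  by apply: time_integral_comb_ge0 => // tau /k0 ->.
have h2 : 0 <= - k1 * (F t a - F 0 a) + - k2 * (F t b - F 0 b) + - k3 * (F t c - F 0 c).
  apply: time_integral_comb_ge0 => // tau /k0 k0'.
  by rewrite !mulNr -!opprD k0' oppr0.
move: h1 h2; rewrite !F0 => h1 h2.
by apply/eqP; rewrite eq_le; apply/andP; split; lra.
Qed.

(** Formally, [l] is the quotient of the integrals of [g] over [[0, s]] and [[0, t]]. As [g] and [k]
    carry no regularity, it is read off from differences of [F], in which [k] cancels. *)
Lemma time_integral_separable (g k : R -> R) (h : V -> R) :
  (forall t p, 0 <= t <= T -> H t p = g t * h p + k t) ->
  (forall t, 0 < t < T -> 0 <= g t) \/ (forall t, 0 < t < T -> g t <= 0) ->
  forall s t, 0 <= s <= t -> t < T ->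
  exists l c, 0 <= l <= 1 /\ forall q, F s q = l * F t q + c.
Proof.
move=> HE gsgn s t /[dup] st /andP[s0 le_st] tT.
have sT : s < T by apply: le_lt_trans tT.
have t0 : 0 <= t by apply: le_trans le_st.
have HE' tau p : 0 < tau < T -> H tau p = g tau * h p + k tau.
  by move=> /andP[a b]; rewrite HE// !ltW.
have F0 q : F 0 q = 0 by exact: time_integral0.
have [[p1 [p2 hp]]|hc] := pselect (exists p1 p2, h p1 <> h p2); last first.
  exists 0, (F s 0); split=> [|q]; first by rewrite lexx ler01.
  have hq : h q = h 0 by apply/not_notP => hq; apply: hc; exists q, 0.
  have := time_integral_comb_eq0 1 (-1) 0 q 0 0 s.
  rewrite s0 sT => /(_ isT)/(_ _)/wrap[tau tauT|]; last lra.
  by rewrite !HE'// hq; ring.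
pose d := h p2 - h p1.
have d0 : d != 0 by rewrite subr_eq0; apply/eqP => /esym.
(* [P r] plays the role of [d] times the integral of [g] over [[0, r]]. *)
pose P r := F r p2 - F r p1.
have FP r q : 0 <= r < T -> d * (F r q - F r p1) = (h q - h p1) * P r.
  move=> rT.
  have := time_integral_comb_eq0 (h q - h p1) (d - (h q - h p1)) (- d) p2 p1 q r rT.
  move=> /(_ _)/wrap[tau tauT|]; last by rewrite /P; lra.
  by rewrite !HE'// /d; ring.
(* The factor [e] is [d] or [-d] according to the sign of [g], so that [e P] is nonnegative and
   nondecreasing in time. *)
have [e [e0 Ps Pst]] : exists e : R, [/\ e != 0, 0 <= e * P s & e * P s <= e * P t].
  have [e [e0 eg]] : exists e : R,
      e != 0 /\ forall tau, 0 < tau < T -> 0 <= e * (g tau * d).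
    case: gsgn => gs; [exists d|exists (- d)]; split; rewrite ?oppr_eq0// => tau /gs g0.
      by rewrite mulrCA mulr_ge0// -expr2 sqr_ge0.
    by rewrite mulNr mulrCA -mulNr mulr_ge0 ?oppr_ge0// -expr2 sqr_ge0.
  exists e; split=> //.
    have := time_integral_comb_ge0 e (- e) 0 p2 p1 0 0 s.
    rewrite lexx s0 => /(_ isT sT); move=> /(_ _)/wrap[tau tauT|]; last first.
      by rewrite !F0 /P; lra.
    by have := eg _ tauT; rewrite !HE'// /d; lra.
  have := time_integral_comb_ge0 e (- e) 0 p2 p1 0 s t st tT.
  move=> /(_ _)/wrap[tau tauT|]; last by rewrite /P; lra.
  by have := eg _ tauT; rewrite !HE'// /d; lra.
have [l [lP l01]] : exists l, P s = l * P t /\ 0 <= l <= 1.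
  (* If [P t = 0], then [P s = 0] by monotonicity and [l = 0] serves. *)
  have [Pt0|Pt0] := eqVneq (P t) 0.
    exists 0; rewrite mul0r lexx ler01; split => //.
    move: Ps Pst; rewrite Pt0 mulr0 => h1 h2.
    have /eqP : e * P s = 0 by apply/eqP; rewrite eq_le h1 h2.
    by rewrite mulf_eq0 (negbTE e0) => /eqP.
  have ePt : 0 < e * P t by rewrite lt_neqAle (le_trans Ps Pst) eq_sym mulf_neq0.
  exists (e * P s / (e * P t)); split; first by field; rewrite e0 Pt0.
  by rewrite divr_ge0 ?(ltW ePt)//= ler_pdivrMr// mul1r.
exists l, (F s p1 - l * F t p1); split=> // q.
have h1 := FP s q; have h2 := FP t q.
rewrite s0 sT in h1; rewrite t0 tT in h2.
apply: (mulfI d0).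
have := h1 isT; have := h2 isT; rewrite lP.
set hh := h q - h p1; move=> e2 e1.
have : hh * (l * P t) = l * (hh * P t) by ring.
rewrite -e1 -e2; lra.
Qed.

End time_integral_structure.

(** * The spatial gradient of the time integral *)

Section time_integral_gradient.
Context {R : realType} {n : nat} (T : R) (H : R -> 'rV[R]_n -> R).
Local Notation V := 'rV[R]_n.
Local Notation A := [set z : R * V | 0 <= z.1 <= T].
Local Notation mu := (@lebesgue_measure R).
Context (H_C1 : C1_on A (fun z : R * V => H z.1 z.2)).

Let F (t : R) (q : V) : R := (\int[mu]_(tau in `[0%R, t]) H tau q)%R.

Lemma time_integral_gradient t m : 0 <= t <= T ->
  exists g : V, forall v,
    h^-1 *: (F t (m + h *: v) - F t m : R^o) @[h --> 0^'] --> (dot g v : R^o).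
Proof.
move=> /andP[t0 tT].
have [dH [dHc dHP]] := H_C1.
pose dHq tau q v : R := dH (tau, q) (0, v).
have dE tau q v : 0 <= tau <= T ->
    h^-1 *: (H tau (q + h *: v) - H tau q : R^o) @[h --> 0^'] --> (dHq tau q v : R^o).
  move=> tauT.
  have := @C1_on_derivative _ _ A _ (dH (tau, q)) (tau, q) (0, v) (dHP (tau, q) tauT).
  move=> /(_ _)/wrap[h|]; first by rewrite /= scaler0 addr0.
  rewrite /=; under eq_fun do rewrite scaler0 addr0.
  exact.
have mD : measurable (`[0, t]%classic : set (measurableTypeR R)).
  exact: measurable_itv.
have iH q : mu.-integrable `[0, t] (EFin \o H^~ q).
  exact: (slice_integrable T H H_C1).
have dHs v : {within `[0, T]%classic `*` `[-1, 1]%classic,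
    continuous (fun z : R * R => dHq z.1 (m + z.2 *: v) v)}.
  apply/subspace_continuousP => -[tau s] [/=]; rewrite !in_itv/= => tauT s1.
  have /subspace_continuousP /(_ (tau, m + s *: v) tauT) := dHc (0, v).
  move=> /cvgrPdist_le tq; apply/cvgrPdist_le => e /tq; rewrite !near_withinE.
  have h1 : (z.1 : R) @[z --> (tau, s)] --> tau by exact: cvg_fst.
  have h2 : m + z.2 *: v @[z --> (tau, s)] --> m + s *: v.
    by apply: cvgD; [exact: cvg_cst|apply: cvgZr_tmp; exact: cvg_snd].
  move=> /(cvg_pair h1 h2); apply: (filterS (F := nbhs (tau, s))) => -[tau' s'] /= h [].
  by rewrite !in_itv/= => /h.
have dHm v : {within `[0, T], continuous (fun tau => dHq tau m v)}.
  apply/subspace_continuousP => tau /=; rewrite in_itv/= => tauT.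
  have /subspace_continuousP /(_ (tau, m) tauT) := dHc (0, v).
  move=> /cvgrPdist_le tq; apply/cvgrPdist_le => e /tq; rewrite !near_withinE.
  have h1 : (z : R) @[z --> tau] --> tau by exact: cvg_id.
  have h2 : m @[z --> tau] --> m by exact: cvg_cst.
  move=> /(cvg_pair h1 h2); apply: (filterS (F := nbhs tau)) => tau' /= h.
  by rewrite in_itv/= => /h.
have dHi v : mu.-integrable `[0, t] (EFin \o (fun tau => dHq tau m v)).
  apply: continuous_compact_integrable; first exact: segment_compact.
  apply: continuous_subspaceW (dHm v).
  by apply: subset_itvScc; rewrite bnd_simp.
pose L v : R := (\int[mu]_(tau in `[0%R, t]) dHq tau m v)%R.
(* Differentiation under the integral along [s |-> m + s v] for [s] in []-1, 1[]; the derivative is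
   dominated by a constant, being continuous on the compact set [[0, T] x [-1, 1]]. *)
have LE v : h^-1 *: (F t (m + h *: v) - F t m : R^o) @[h --> 0^'] --> (L v : R^o).
  have cK : compact (`[0, T]%classic `*` `[-1, 1]%classic : set (R * R)).
    by apply: compact_setX; exact: segment_compact.
  have /compact_bounded[M [_ HM]] := continuous_compact (dHs v) cK.
  pose f s tau := H tau (m + s *: v).
  have fE s tau h : f (h + s) tau - f s tau =
      H tau (m + s *: v + h *: v) - H tau (m + s *: v).
    by rewrite /f scalerDl [_ *: v + _]addrC addrA.
  have fd s tau : 0 <= tau <= T ->
      h^-1 *: (f (h + s) tau - f s tau : R^o) @[h --> 0^'] -->
      (dHq tau (m + s *: v) v : R^o).
    by move=> tauT; under eq_fun do rewrite fE; exact: dE.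
  have d1E s tau : 0 <= tau <= T -> partial1of2 f s tau = dHq tau (m + s *: v) v.
    by move=> tauT; apply/cvg_lim => //; exact: fd.
  have tauP tau : `[0, t]%classic tau -> 0 <= tau <= T.
    by rewrite /= in_itv/= => /andP[-> /le_trans ->].
  have := @cvg_differentiation_under_integral R _ _ mu f `[0, t]%classic mD 0 (-1) 1.
  move=> /(_ _)/wrap[|]; first by rewrite /= in_itv/= ltrN10 ltr01.
  move=> /(_ _)/wrap[s _|]; first exact: iH.
  move=> /(_ _)/wrap[s tau _ /tauP tauT|].
    apply/cvg_ex; exists (dHq tau (m + s *: v) v) => /=.
    by under eq_fun do rewrite [_ *: 1]mulr1; exact: fd.
  move=> /(_ (fun=> `|M| + 1))/(_ _)/wrap[y|]; first by rewrite addr_ge0.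
  move=> /(_ _)/wrap[|].
    apply: continuous_compact_integrable; first exact: segment_compact.
    by apply: continuous_subspaceT => x; exact: cvg_cst.
  move=> /(_ _)/wrap[s tau|].
    rewrite /= in_itv/= => /andP[/ltW s1 /ltW s2] /tauP tauT; rewrite d1E//.
    apply: HM; first by rewrite (le_lt_trans (ler_norm _))// ltrDl.
    by exists (tau, s) => //; split; rewrite /= in_itv/= ?s1.
  rewrite [X in _ --> X -> _](_ : _ = L v); last first.
    apply: eq_Rintegral => tau /[!inE] /tauP tauT.
    by rewrite d1E// scale0r addr0.
  rewrite /f; under eq_fun do rewrite addr0 scale0r addr0.
  exact.
have LD v w : L (v + w) = L v + L w.
  rewrite /L -(RintegralD mD (dHi v) (dHi w)).
  apply: eq_Rintegral => tau _; rewrite /dHq -linearD; congr (dH _ (_, _)).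
  by rewrite addr0.
have LZ k v : L (k *: v) = k * L v.
  rewrite /L -(RintegralZl _ mD (dHi v)).
  apply: eq_Rintegral => tau _; rewrite /dHq.
  have <- : dH (tau, m) (k *: (0, v)) = k * dH (tau, m) (0, v) by exact: linearZ.
  by congr (dH _ (_, _)); rewrite scaler0.
have L0 : L 0 = 0 by rewrite -(scale0r 0) LZ mul0r.
exists (\row_i L (delta_mx ord0 i)) => v.
have -> : dot (\row_i L (delta_mx ord0 i)) v = L v; last exact: LE.
rewrite [in RHS](row_sum_delta v) (big_morph _ LD L0); apply: eq_bigr => i _.
by rewrite mxE LZ mulrC.
Qed.

End time_integral_gradient.

(** * Differentiability of the Hopf formula at a unique maximizer *)

Lemma emax_eq {R : realType} (A : set (\bar R)) m : A m -> ubound A m -> emax A = m.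
Proof.
move=> Am mA; rewrite /emax; case: xgetP => [y -> [Ay yA]|/(_ m)]; last by case.
by apply/eqP; rewrite eq_le mA// yA.
Qed.

Section hopf_formula.
Context {R : realType} {n : nat} (T : R) (H : R -> 'rV[R]_n -> R) (sigma : 'rV[R]_n -> R).
Local Notation V := 'rV[R]_n.
Local Notation A := [set z : R * V | 0 <= z.1 <= T].
Local Notation mu := (@lebesgue_measure R).
Context (H_C1 : C1_on A (fun z : R * V => H z.1 z.2)).
Context (sigma_lip : lipschitz sigma).
Context (D0 : conj_dom sigma !=set0).

Let F (t : R) (q : V) : R := (\int[mu]_(tau in `[0%R, t]) H tau q)%R.
Let D := conj_dom sigma.
Let f t := rconj sigma \+ F t.

(** Off the domain of the conjugate [phi] is [-oo], so maximizing over [D] is maximizing over the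
    whole space. *)
Lemma hopf_is_max t x p : is_max D (f t) x p -> hopf H sigma t x = dot x p - f t p.
Proof.
move=> [Dp pm].
have phiE q : D q -> phi H sigma t x q = (dot x q - f t q)%:E.
  by move=> Dq; rewrite /phi fenchel_dom// -EFinB opprD addrA.
rewrite /hopf (@emax_eq _ _ (dot x p - f t p)%:E)//.
  by exists p => //; rewrite phiE.
move=> _ [q _ <-]; have [Dq|nDq] := pselect (D q).
  by rewrite phiE// lee_fin pm.
by rewrite /phi fenchel_ndom// leNye.
Qed.

Lemma hopf_attained t : 0 <= t <= T -> forall x,
  exists2 p, is_max D (f t) x p & hopf H sigma t x = dot x p - f t p.
Proof.
move=> tT x.
have [|c||p Dp pm] := @compact_sublevel_min R V D (fun q => f t q - dot x q).
- exact: D0.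
- rewrite (_ : mkset _ = [set q | D q /\ rconj sigma q + (F t q - dot x q) <= c]).
    apply: conj_sublevel_compact => // q.
    apply: (cvgB (F := nbhs q)); last exact: dot_continuous.
    exact: (time_integral_continuous T H H_C1).
  by apply: eq_set => q; rewrite /f/= addrA.
- exact: norm_hausdorff.
have xp : is_max D (f t) x p by split=> // q /pm; lra.
by exists p => //; exact: hopf_is_max.
Qed.

Context (t0 : R) (x0 p0 : V) (t0T : 0 < t0 < T).
Context (p0_max : is_max D (f t0) x0 p0).
Context (p0_unique : forall p, is_max D (f t0) x0 p -> p = p0).

Let in0T : \forall z \near (t0, x0), 0 <= z.1 <= T.
Proof.
have [t00 t0T'] := andP t0T.
have : \forall z \near t0, 0 <= z <= T.
  near=> z; apply/andP; split; apply/ltW; near: z.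
    exact: lt_nbhsr.
  exact: lt_nbhsl.
by move=> /(@cvg_fst _ _ (nbhs t0) (nbhs x0) _ _).
Unshelve. all: by end_near. Qed.

(** Points of [D] at distance at least [d] from [p0] lose a fixed amount at [(t0, x0)], by
    compactness and uniqueness; a small move of [(t, x)] cannot make up for it. *)
Lemma near_max_close d : 0 < d ->
  \forall z \near (t0, x0), forall p, is_max D (f z.1) z.2 p -> `|p - p0| < d.
Proof.
move=> d_gt0.
pose D' := [set q | D q /\ d <= `|q - p0|].
have [[q' D'q']|D'0] := pselect (D' !=set0); last first.
  near=> z => p [Dp _]; rewrite ltNge; apply/negP => dp.
  by apply: D'0; exists p.
pose g q := f t0 q - dot x0 q.
have [|c||q1 [Dq1 dq1] q1min] := @compact_sublevel_min R V D' g.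
- by exists q'.
- rewrite (_ : mkset _ =
    [set q | D q /\ rconj sigma q + (F t0 q - dot x0 q) <= c] `&`
    [set q | d <= `|q - p0|]).
    apply: compact_closedI.
      apply: conj_sublevel_compact => // q.
      apply: (cvgB (F := nbhs q)); last exact: dot_continuous.
      by apply: (time_integral_continuous T H H_C1); have [/ltW-> /ltW->] := andP t0T.
    apply: (@closed_comp _ _ (fun q : V => `|q - p0|) [set y | d <= y]) => [q _|].
      apply: (cvg_norm (F := nbhs q)); apply: (cvgB (F := nbhs q)); last exact: cvg_cst.
      exact: cvg_id.
    exact: closed_ge.
  by apply/seteqP; split => q /=; rewrite /g /f/= addrA => -[[? ?] ?].
- exact: norm_hausdorff.
have eta0 : 0 < g q1 - g p0.
  rewrite subr_gt0 ltNge; apply/negP => gq.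
  have q1p0 : q1 = p0.
    apply: p0_unique; split=> // q Dq; have := p0_max.2 q Dq; rewrite /g in gq; lra.
  by move: dq1; rewrite q1p0 subrr normr0 leNgt d_gt0.
have [k kD] := conj_dom_bounded _ sigma_lip.
have [M M0 FM] := time_integral_lipschitz T H H_C1 k.
have k0 : 0 <= k by apply: le_trans (kD _ Dq1).
(* [2 * M] covers the change of [F] at [p] and at [p0], and [n%:R * (2 * k)] covers
   [<x - x0, p - p0>] with [|p - p0| <= 2 k]; adding 1 makes [K] positive. *)
pose K := 2 * M + n%:R * (2 * k) + 1.
have K0 : 0 < K by rewrite ltr_wpDl// addr_ge0 ?mulr_ge0.
have zclose : \forall z \near (t0, x0), `|(t0, x0) - z| < (g q1 - g p0) / K.
  by apply: (cvgr_dist_lt (F := nbhs (t0, x0))); [exact: cvg_id|rewrite divr_gt0].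
move: in0T zclose; apply: (filterS2 (F := nbhs (t0, x0))) => -[t x] /= tT.
rewrite ltr_pdivlMr// prod_normE/= => zc p [Dp pm].
rewrite ltNge; apply/negP => dp.
have := q1min p (conj Dp dp).
have t0T' : 0 <= t0 <= T by have [/ltW-> /ltW->] := andP t0T.
have Dp0 := p0_max.1.
have h1 := FM t0 t p t0T' tT (kD _ Dp).
have h2 := FM t0 t p0 t0T' tT (kD _ Dp0).
have := pm p0 Dp0.
have h3 : `|dot (x - x0) (p - p0)| <= n%:R * `|x - x0| * (2 * k).
  rewrite (le_trans (norm_dot_le _ _))// ler_wpM2l// ?mulr_ge0//.
  rewrite (le_trans (ler_normB _ _))// mulrDl mul1r lerD ?kD//.
move: zc; rewrite distrC (distrC x0).
set N := Num.max _ _ => zc.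
have tN : `|t - t0| <= N by rewrite le_max lexx.
have xN : `|x - x0| <= N by rewrite le_max lexx orbT.
have h1' : `|F t p - F t0 p| <= M * N by rewrite (le_trans h1)// ler_wpM2l.
have h2' : `|F t p0 - F t0 p0| <= M * N by rewrite (le_trans h2)// ler_wpM2l.
have h3' : `|dot (x - x0) (p - p0)| <= n%:R * (2 * k) * N.
  by rewrite (le_trans h3)// mulrAC ler_wpM2l// !mulr_ge0.
have N0 : 0 <= N by rewrite (le_trans _ tN).
move: h1' h2' h3'; rewrite !ler_norml !dotE => /andP[a1 a2] /andP[b1 b2] /andP[c1 c2].
move: zc; rewrite /K /g /f/=.
set MN := M * N in a1 a2 b1 b2; set nN := n%:R * (2 * k) * N in c1 c2.
have -> : N * (2 * M + n%:R * (2 * k) + 1) = 2 * MN + nN + N by rewrite /MN /nN; ring.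
lra.
Unshelve. all: by end_near. Qed.

(** Envelope argument: testing [p0] at [(t, x)] bounds the increment below, testing [p] at
    [(t0, x0)] bounds it above. The bounds differ from the linear part by the time expansion errors
    and [<x - x0, p - p0>]. *)
Lemma hopf_expansion e : 0 < e -> \forall z \near (t0, x0),
  `|hopf H sigma z.1 z.2 - hopf H sigma t0 x0
    - (dot p0 (z.2 - x0) - H t0 p0 * (z.1 - t0))| <= e * `|z - (t0, x0)|.
Proof.
move=> e_gt0.
have t0T' : 0 <= t0 <= T by have [/ltW-> /ltW->] := andP t0T.
have e2 : 0 < e / 2 by rewrite divr_gt0.
have Ht0 := time_integral_expansion T H H_C1 t0 p0 (e / 2) t0T' e2.
have /nbhs_ballP[r /= r0 rH] := Ht0.
(* The first bound keeps [p] where the time expansion holds; the second makes [n d <= e / 2]. *)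
pose d := Num.min r (e / 2 / (n%:R + 1)).
have n1 : 0 < n%:R + 1 :> R by rewrite ltr_wpDl.
have d0 : 0 < d by rewrite lt_min r0 divr_gt0.
have zr : \forall z \near (t0, x0), `|(t0, x0) - z| < r.
  by apply: (cvgr_dist_lt (F := nbhs (t0, x0))); first exact: cvg_id.
have znear := near_max_close d d0.
move: zr; apply: (filterS3 (F := nbhs (t0, x0)) _ _ in0T znear) => -[t x] /= tT pclose zr.
have tr : `|t0 - t| < r by rewrite (le_lt_trans _ zr)// prod_normE/= le_max lexx.
have [p xp ->] := hopf_attained t tT x.
rewrite (hopf_is_max t0 x0 p0 p0_max).
have pp0 := pclose p xp.
have [Dp pm] := xp; have [Dp0 p0m] := p0_max.
have Ep : `|F t p - F t0 p - H t0 p0 * (t - t0)| <= e / 2 * `|t - t0|.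
  apply: (rH (t, p)) => //; split; first by rewrite -ball_normE.
  by rewrite /= -ball_normE /ball_/= distrC (lt_le_trans pp0)// ge_min lexx.
have Ep0 : `|F t p0 - F t0 p0 - H t0 p0 * (t - t0)| <= e / 2 * `|t - t0|.
  apply: (rH (t, p0)) => //; split; first by rewrite -ball_normE.
  exact: ballxx.
have := pm p0 Dp0; have := p0m p Dp.
have dxp : `|dot (x - x0) (p - p0)| <= e / 2 * `|x - x0|.
  rewrite (le_trans (norm_dot_le _ _))// mulrAC ler_wpM2r//.
  have : `|p - p0| <= e / 2 / (n%:R + 1).
    by rewrite (le_trans (ltW pp0))// ge_min lexx orbT.
  rewrite ler_pdivlMr//; apply: le_trans.
  by rewrite mulrC ler_wpM2l// lerDl.
have -> : (t, x) - (t0, x0) = (t - t0, x - x0) by [].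
rewrite prod_normE/=.
set N := Num.max _ _.
have tN : e / 2 * `|t - t0| <= e / 2 * N by rewrite ler_wpM2l ?(ltW e2)// le_max lexx.
have xN : e / 2 * `|x - x0| <= e / 2 * N.
  by rewrite ler_wpM2l ?(ltW e2)// le_max lexx orbT.
move: dxp Ep Ep0; rewrite !ler_norml /f/= !dotE (dotC p0 x) (dotC p0 x0).
set HT := H t0 p0 * (t - t0).
move=> /andP[a1 a2] /andP[b1 b2] /andP[c1 c2] m1 m2.
apply/andP; split; lra.
Qed.

Lemma hopf_differentiable :
  differentiable (fun z : R * V => hopf H sigma z.1 z.2) (t0, x0).
Proof.
pose df (z : R * V) : R^o := dot p0 z.2 - H t0 p0 * z.1.
have df_linear : linear df.
  move=> k a b; rewrite /df /= !dotE.
  have -> : k *: a.1 = k * a.1 by [].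
  have -> : k *: (dot p0 a.2 - H t0 p0 * a.1 : R^o) =
      k * (dot p0 a.2 - H t0 p0 * a.1) by [].
  by ring.
pose dfM := GRing.isLinear.Build _ _ _ _ _ df_linear.
pose dfL : {linear (R * V)%type -> R^o} := HB.pack df dfM.
have dfc : continuous dfL.
  move=> z; apply: (cvgB (F := nbhs z)).
    have h : w.2 @[w --> z] --> z.2 by exact: cvg_snd.
    by apply: (continuous_cvg _ (@dot_continuous R n p0 z.2)); exact: h.
  by apply: (cvgMl_tmp (F := nbhs z)); exact: cvg_fst.
pose u (z : R * V) : R^o := hopf H sigma z.1 z.2.
have uE : u \o shift (t0, x0) = cst (u (t0, x0)) + dfL +o_ (0 : R * V) id.
  apply/eqaddoP => e e0.
  have := hopf_expansion e e0; rewrite (near_shift 0) subr0 /=.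
  apply: (filterS (F := nbhs (0 : R * V))) => z /=.
  by rewrite /u /= !addrK -[X in `|X|]addrA -opprD.
apply/diff_locallyP; rewrite (diff_unique dfc uE); split => //.
Qed.

End hopf_formula.

(** * Uniqueness of maximizers backward in time *)

(** By convexity of [f + C] the midpoint is a maximizer as well. Equality in the sum of two
    convexity inequalities forces equality in each, so [f] is affine there and [segment_max_unique]
    applies. *)
Lemma sum_max_unique {R : realType} {n : nat} {D : set 'rV[R]_n} (f C : 'rV[R]_n -> R)
    (x0 q1 q2 g : 'rV[R]_n) :
  (forall (a b : 'rV[R]_n) (l : R), D a -> D b -> 0 <= l <= 1 ->
    D (l *: a + (1 - l) *: b) /\
    f (l *: a + (1 - l) *: b) <= l * f a + (1 - l) * f b) ->
  (forall (a b : 'rV[R]_n) (l : R), 0 <= l <= 1 ->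
    C (l *: a + (1 - l) *: b) <= l * C a + (1 - l) * C b) ->
  (forall x p q, is_max D f x p -> is_max D f x q -> p = q) ->
  (forall v, h^-1 *: (C (2^-1 *: q1 + (1 - 2^-1) *: q2 + h *: v) -
     C (2^-1 *: q1 + (1 - 2^-1) *: q2) : R^o) @[h --> 0^'] --> (dot g v : R^o)) ->
  is_max D (f \+ C) x0 q1 -> is_max D (f \+ C) x0 q2 -> q1 = q2.
Proof.
move=> cf cC fU Cm [Dq1 m1] [Dq2 m2].
have h01 : 0 <= (2^-1 : R) <= 1 by apply/andP; split; lra.
have [Dm fm] := cf q1 q2 _ Dq1 Dq2 h01; have {cC}Cle := cC q1 q2 _ h01.
have e12 := m1 q2 Dq2; have e21 := m2 q1 Dq1; have e1m := m1 _ Dm.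
have mE : dot x0 (2^-1 *: q1 + (1 - 2^-1) *: q2) =
   2^-1 * dot x0 q1 + (1 - 2^-1) * dot x0 q2 by rewrite !dotE.
set m := _ + _ in Cm Dm fm Cle e1m mE.
apply: (segment_max_unique C x0 q1 q2 g cf fU Cm Dq1 Dq2).
  split=> // q /m1; move: e1m e12 e21; rewrite /= mE -/m; lra.
by move: e1m e12 e21; rewrite /= mE -/m; lra.
Qed.

Section backward_uniqueness.
Context {R : realType} {n : nat} (T : R) (H : R -> 'rV[R]_n -> R) (sigma : 'rV[R]_n -> R).
Local Notation V := 'rV[R]_n.
Local Notation A := [set z : R * V | 0 <= z.1 <= T].
Local Notation mu := (@lebesgue_measure R).
Context (H_C1 : C1_on A (fun z : R * V => H z.1 z.2)).
Context (sigma_convex : convex_function setT sigma).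
Context (sigma_C1 : C1_on setT sigma).
Context (A2 : condA2 T H).
Context (sigma_lip : lipschitz sigma).

Let F (t : R) (q : V) : R := (\int[mu]_(tau in `[0%R, t]) H tau q)%R.
Let D := conj_dom sigma.
Let s := rconj sigma.
Let f t := rconj sigma \+ F t.

Lemma max_unique_backward t0 t1 : 0 < t0 -> t0 < t1 < T ->
  (forall x v, derivable (hopf H sigma t1 : V -> R^o) x v) ->
  forall x p q, is_max D (f t0) x p -> is_max D (f t0) x q -> p = q.
Proof.
move=> t0_gt0 /andP[t01 t1T] du x q1 q2 xq1 xq2.
have t0T : 0 <= t0 <= T by rewrite !ltW// (lt_trans t01).
have t1T' : 0 <= t1 <= T by rewrite !ltW// (lt_trans t0_gt0).
have F0 q : F 0 q = 0 by exact: time_integral0.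
have [ds [G gradG]] := convex_C1_gradient sigma sigma_convex sigma_C1.
have DG := conj_max sigma G gradG.
have D0 : D !=set0 by exists (G 0); have [[]] := DG 0.
(* Here [sigma] is in the role of [u]: its differentiability makes maximizers for its conjugate
   unique. *)
have sU : forall x p q, is_max D s x p -> is_max D s x q -> p = q.
  apply: (is_max_unique (derivable_touch_unique _ ds)) => y.
  by have [ym yE] := DG y; exists (G y).
have u1E := hopf_attained T H sigma H_C1 sigma_lip D0 t1 t1T'.
have u1U := derivable_touch_unique _ du.
have f1U := is_max_unique u1U u1E.
have f1cpt c : compact [set q | D q /\ f t1 q <= c].
  apply: conj_sublevel_compact => //.
  exact: (time_integral_continuous T H H_C1).
have f1cvx := touch_unique_convex f1cpt u1U u1E.
have scvx (a b : V) (l : R) : D a -> D b -> 0 <= l <= 1 ->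
    D (l *: a + (1 - l) *: b) /\ s (l *: a + (1 - l) *: b) <= l * s a + (1 - l) * s b.
  exact: conj_convex.
pose m : V := 2^-1 *: q1 + (1 - 2^-1) *: q2.
have [g0 Fg0] := time_integral_gradient T H H_C1 t0 m t0T.
have [g1 Fg1] := time_integral_gradient T H H_C1 t1 m t1T'.
have forward_case : (forall (a b : V) (l : R), 0 <= l <= 1 ->
    F t0 (l *: a + (1 - l) *: b) <= l * F t0 a + (1 - l) * F t0 b) -> q1 = q2.
  by move=> cF; exact: (sum_max_unique s (F t0) x q1 q2 g0 scvx cF sU Fg0 xq1 xq2).
(* Write [f t0] as [f t1] plus [F t0 - F t1]; convexity of [f t1] and uniqueness of its maximizers
   come from differentiability at time [t1]. *)
have backward_case : (forall (a b : V) (l : R), 0 <= l <= 1 ->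
    F t0 (l *: a + (1 - l) *: b) - F t1 (l *: a + (1 - l) *: b) <=
    l * (F t0 a - F t1 a) + (1 - l) * (F t0 b - F t1 b)) -> q1 = q2.
  move=> cF.
  have fE : f t0 = f t1 \+ (fun q => F t0 q - F t1 q).
    by apply/funext => q; rewrite /f /=; ring.
  have Cg v : h^-1 *: (F t0 (m + h *: v) - F t1 (m + h *: v) - (F t0 m - F t1 m) : R^o)
      @[h --> 0^'] --> (dot (g0 - g1) v : R^o).
    rewrite !dotE.
    rewrite (_ : (fun h => _) = (fun h => h^-1 *: (F t0 (m + h *: v) - F t0 m : R^o)) \-
      (fun h => h^-1 *: (F t1 (m + h *: v) - F t1 m : R^o))); last first.
      by apply/funext => h /=; rewrite -scalerBr; congr (_ *: _); ring.
    by apply: cvgB; [exact: Fg0|exact: Fg1].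
  rewrite fE in xq1 xq2.
  exact: (sum_max_unique (f t1) _ x q1 q2 (g0 - g1) f1cvx cF f1U Cg xq1 xq2).
case: A2 => [[Hcvx|Hccv]|[g [h [k [HE gsgn]]]]].
- apply: forward_case => a b l l01; set q : V := l *: a + _.
  have : 0 <= l * (F t0 a - F 0 a) + (1 - l) * (F t0 b - F 0 b) + -1 * (F t0 q - F 0 q).
    apply: (time_integral_comb_ge0 T H H_C1); first by rewrite lexx ltW.
      exact: lt_trans t1T.
    by move=> tau tauT; have := convex_functionE _ (Hcvx tau tauT) a b l l01; lra.
  by rewrite !F0; lra.
- apply: backward_case => a b l l01; set q : V := l *: a + _.
  have : 0 <= - l * (F t1 a - F t0 a)
      + - (1 - l) * (F t1 b - F t0 b) + 1 * (F t1 q - F t0 q).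
    apply: (time_integral_comb_ge0 T H H_C1) => //; first by rewrite !ltW.
    by move=> tau tauT; have := convex_functionE _ (Hccv tau tauT) a b l l01; lra.
  by lra.
have t01' : 0 <= t0 <= t1 by rewrite !ltW.
have [l [c [l01 FE]]] := time_integral_separable T H H_C1 g k h HE gsgn t0 t1 t01' t1T.
have {}FE q : F t0 q = l * F t1 q + c by exact: FE.
(* If [l = 1], the difference [F t0 - F t1] is constant, hence convex. *)
have [l1|l1] := eqVneq l 1.
  by apply: backward_case => a b r _; rewrite !FE l1; lra.
have l_lt1 : 0 < 1 - l by rewrite subr_gt0 lt_neqAle l1 (andP l01).2.
have h01 : 0 <= (2^-1 : R) <= 1 by apply/andP; split; lra.
have [Dq1 m1] := xq1; have [Dq2 m2] := xq2.
have [Dm sm] := scvx q1 q2 _ Dq1 Dq2 h01; have [_ f1m] := f1cvx q1 q2 _ Dq1 Dq2 h01.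
have e12 := m1 q2 Dq2; have e21 := m2 q1 Dq1; have e1m := m1 _ Dm.
have mE : dot x m = 2^-1 * dot x q1 + (1 - 2^-1) * dot x q2 by rewrite !dotE.
rewrite -/m in Dm sm f1m e1m.
(* Both functions are convex and [s] has positive weight, so equality at the midpoint forces [s] to
   be affine there. [F t0] may fail to be convex, so [segment_max_unique] is applied directly. *)
have fE q : f t0 q = (1 - l) * s q + l * f t1 q + c.
  by rewrite /f/= FE -/s; ring.
have lf1m : l * f t1 m <= l * (2^-1 * f t1 q1 + (1 - 2^-1) * f t1 q2).
  by rewrite ler_wpM2l// (andP l01).1.
have lsm : (1 - l) * s m <= (1 - l) * (2^-1 * s q1 + (1 - 2^-1) * s q2).
  by rewrite ler_pM2l.
apply: (segment_max_unique (F t0) x q1 q2 g0 scvx sU Fg0 Dq1 Dq2).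
  split=> // q Dq; have := m1 q Dq.
  by rewrite -[s \+ F t0]/(f t0) -/m mE; move: e1m e12 e21; rewrite mE !fE; lra.
rewrite -/m -(ler_pM2l l_lt1).
by move: e1m e12 e21; rewrite mE !fE; lra.
Qed.

End backward_uniqueness.

(** * Propagation of singularities forward in time *)

Theorem corollary3p7 (R : realType) (n : nat) (T : R)
    (H : R -> 'rV[R]_n -> R) (sigma : 'rV[R]_n -> R)
    (T_gt0 : 0 < T)
    (H_C1 : C1_on [set z : R * 'rV[R]_n | 0 <= z.1 <= T]
                  (fun z : R * 'rV[R]_n => H z.1 z.2))
    (sigma_convex : convex_function setT sigma)
    (sigma_C1 : C1_on setT sigma)
    (A1 : condA1 T H sigma)
    (A2 : condA2 T H)
    (sigma_lipschitz : lipschitz sigma)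
    (t0 : R) (x0 : 'rV[R]_n)
    (sing0 : singular T (hopf H sigma) t0 x0) :
  forall eps : R, 0 < eps -> forall t : R, t0 < t < T ->
    exists x : 'rV[R]_n,
      [/\ singular T (hopf H sigma) t x,
          (t, x) <> (t0, x0) &
          exists m : nat, enorm (x - x0) <= m%:R * eps].
Proof.
move=> eps eps0 t tT; have [t0t t_ltT] := andP tT.
have [/andP[t0_gt0 t0_ltT] ndiff] := sing0.
suff [x xsing] : exists x, singular T (hopf H sigma) t x.
  exists x; split=> //; first by case=> tt0 _; rewrite tt0 ltxx in t0t.
  (* The multiple [m] is chosen after [x]; the successor compensates for truncation. *)
  exists (Num.truncn (enorm (x - x0) / eps)).+1.
  by rewrite -ler_pdivrMr// ltW// truncnS_gt.
apply/not_existsP => nsing.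
(* Joint differentiability at [(t, x)] is restricted to the direction [(0, v)]. *)
have du x v : derivable (hopf H sigma t : _ -> R^o) x v.
  have xdiff : differentiable (fun z : R * 'rV[R]_n => hopf H sigma z.1 z.2) (t, x).
    apply/not_notP => xndiff; apply: (nsing x); split=> //.
    by rewrite (lt_trans t0_gt0).
  have := @diff_derivable _ _ _ _ _ (0, v) xdiff.
  rewrite /derivable/=; under eq_fun do rewrite scaler0 add0r.
  exact.
have max_unique := max_unique_backward T H sigma H_C1 sigma_convex sigma_C1 A2
  sigma_lipschitz t0 t t0_gt0 tT du.
have t0T' : 0 <= t0 <= T by rewrite !ltW.
have [ds [G gradG]] := convex_C1_gradient sigma sigma_convex sigma_C1.
have D0 : conj_dom sigma !=set0.
  by exists (G 0); have [[]] := conj_max sigma G gradG 0.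
have [p0 p0max _] := hopf_attained T H sigma H_C1 sigma_lipschitz D0 t0 t0T' x0.
apply: ndiff.
apply: (hopf_differentiable T H sigma H_C1 sigma_lipschitz D0 t0 x0 p0) => //.
  by rewrite t0_gt0.
by move=> p /max_unique; exact.
Qed.
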